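(* Let $\mathfrak L$ be the structure with domain $\mathbb Q$ and signature $\tau_0 := \{<,1\}\cup\{c\cdot\}_{c\in\mathbb Q}$, where $<$ is interpreted as the strict linear order of $\mathbb Q$, the constant symbol $1$ is interpreted as the rational number $1$, and for each $c\in\mathbb Q$ the unary function symbol $c\cdot$ is interpreted as the map $x\mapsto cx$. Then $\mathfrak L$ has quantifier elimination: every first-order $\tau_0$-formula is equivalent over $\mathfrak L$ to a quantifier-free $\tau_0$-formula.
   Context: First-order formulas are built from atomic formulas (including the special atomic formulas $\top$ and $\bot$ for truth and falsity) using connectives and quantifiers. Two formulas are equivalent over a structure if they are satisfied by the same assignments of elements to their free variables. *)

(* Defs.v *)
From HB Require Import structures.
From mathcomp Require Import all_boot all_order all_algebra.

Set Implicit Arguments.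
Unset Strict Implicit.
Unset Printing Implicit Defensive.

Import Order.TTheory GRing.Theory Num.Theory.
Local Open Scope ring_scope.

(* Constant symbols are the function symbols of arity 0. *)
Record signature : Type := Signature {
  fun_symb : Type;
  fun_arity : fun_symb -> nat;
  rel_symb : Type;
  rel_arity : rel_symb -> nat
}.

Record structure (S : signature) : Type := Structure {
  dom :> Type;
  fun_interp : forall f : fun_symb S, ('I_(fun_arity f) -> dom) -> dom;
  rel_interp : forall r : rel_symb S, ('I_(rel_arity r) -> dom) -> Prop
}.

(* Variables are named by natural numbers. *)
Inductive term (S : signature) : Type :=
| TVar of nat
| TApp (f : fun_symb S) of ('I_(fun_arity f) -> term S).

Inductive formula (S : signature) : Type :=
| FTrue
| FFalse
| FEq of term S & term S
| FRel (r : rel_symb S) of ('I_(rel_arity r) -> term S)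
| FNot of formula S
| FAnd of formula S & formula S
| FOr of formula S & formula S
| FImp of formula S & formula S
| FExists of nat & formula S
| FForall of nat & formula S.

Fixpoint quantifier_free (S : signature) (phi : formula S) : bool :=
  match phi with
  | FTrue | FFalse | FEq _ _ | FRel _ _ => true
  | FNot p => quantifier_free p
  | FAnd p q | FOr p q | FImp p q => quantifier_free p && quantifier_free q
  | FExists _ _ | FForall _ _ => false
  end.

Fixpoint eval (S : signature) (M : structure S) (v : nat -> M) (t : term S) : M :=
  match t with
  | TVar x => v x
  | TApp f args => fun_interp (fun i => eval v (args i))
  end.

Definition update (D : Type) (v : nat -> D) (x : nat) (a : D) : nat -> D :=
  fun y => if y == x then a else v y.

Fixpoint sat (S : signature) (M : structure S) (v : nat -> M)
    (phi : formula S) : Prop :=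
  match phi with
  | FTrue => True
  | FFalse => False
  | FEq s t => eval v s = eval v t
  | FRel r args => rel_interp (fun i => eval v (args i))
  | FNot p => ~ sat v p
  | FAnd p q => sat v p /\ sat v q
  | FOr p q => sat v p \/ sat v q
  | FImp p q => sat v p -> sat v q
  | FExists x p => exists a : M, sat (update v x a) p
  | FForall x p => forall a : M, sat (update v x a) p
  end.

(* Assignments are total; the values of the variables that are free in neither
   formula are irrelevant to satisfaction. *)
Definition equivalent_over (S : signature) (M : structure S)
    (phi psi : formula S) : Prop :=
  forall v : nat -> M, sat v phi <-> sat v psi.

Definition has_quantifier_elimination (S : signature) (M : structure S) : Prop :=
  forall phi : formula S,
    exists psi : formula S, quantifier_free psi /\ equivalent_over M phi psi.

Inductive tau0_fun : Type :=
| One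
| Scale of rat.

Inductive tau0_rel : Type :=
| Less.

Definition tau0 : signature := {|
  fun_symb := tau0_fun;
  fun_arity f := match f with One => 0%N | Scale _ => 1%N end;
  rel_symb := tau0_rel;
  rel_arity r := match r with Less => 2%N end
|}.

Definition structL : structure tau0 := {|
  dom := rat;
  fun_interp f :=
    match f return ('I_(@fun_arity tau0 f) -> rat) -> rat with
    | One => fun _ => 1
    | Scale c => fun a => c * a ord0
    end;
  rel_interp r :=
    match r return ('I_(@rel_arity tau0 r) -> rat) -> Prop with
    | Less => fun a => a ord0 < a ord_max
    end
|}.

(* Main.v *)
Require Import Defs.
From HB Require Import structures.
From mathcomp Require Import all_boot all_order all_algebra.
From mathcomp Require Import lra.
From Stdlib Require Import List.

(** Eliminating [exists x] from a quantifier-free formula [phi]: every term is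
    a multiple of a single variable or a constant, so each atom of [phi] compares
    [x] with a value [eval v u] for [u] in a finite list [T] of terms.  Such a
    comparison has a truth value expressible without [x] when [x] is below all of
    [T], when [x = u], and when [x] lies infinitesimally above [u], for [u] in [T]
    (virtual substitution).  These finitely many regions are nonempty and cover
    the line; midpoints of terms, which are not terms, are never needed. *)

Set Implicit Arguments.
Unset Strict Implicit.
Unset Printing Implicit Defensive.

Import Order.TTheory GRing.Theory Num.Theory.
Local Open Scope ring_scope.

(** * Finitely many cut points on the rational line *)

Section FiniteCuts.

Variables (A : Type) (f : A -> rat).

Lemma exists_below (T : list A) : exists a, forall u, In u T -> a < f u.
Proof.
elim: T => [|u T [a lt_aT]]; first by exists 0.
exists (Num.min a (f u - 1)) => w [<-|/lt_aT lt_aw]; rewrite gt_min.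
  by apply/orP; right; lra.
by rewrite lt_aw.
Qed.

(** By density, the midpoint of [b] and each new value above [b] caps [a]; taking minima preserves
    the earlier bounds. *)
Lemma exists_just_above (b : rat) (T : list A) :
  exists a, b < a /\ forall u, In u T -> f u <= b \/ a < f u.
Proof.
elim: T => [|u T [a [lt_ba aT]]]; first by exists (b + 1); split=> //; lra.
have [le_ub|lt_bu] := leP (f u) b.
  by exists a; split=> // w [<-|/aT]; [left|].
exists (Num.min a ((b + f u) / 2)); split; first by rewrite lt_min lt_ba; lra.
move=> w [<-|/aT [le_wb|lt_aw]]; [right|by left|right]; rewrite gt_min.
  by apply/orP; right; lra.
by rewrite lt_aw.
Qed.

(** If [a] is not below all values, [t] is chosen with the largest value not exceeding [a]. *)
Lemma below_or_at_or_just_above (a : rat) (T : list A) :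
  (forall u, In u T -> a < f u) \/
  exists t, In t T /\ (a = f t \/
    (f t < a /\ forall u, In u T -> f u <= f t \/ a < f u)).
Proof.
elim: T => [|u T IH]; first by left.
have [lt_au|lt_ua|->] := ltgtP a (f u); last first.
- by right; exists u; split; [left|left].
- right; case: IH => [lt_aT|[t [tT [eq_at|[lt_ta cutT]]]]].
  + exists u; split; [by left|right; split=> // w [<-|/lt_aT]].
      by left.
    by right.
  + by exists t; split; [right|left].
  + have [le_ut|lt_tu] := leP (f u) (f t).
      exists t; split; [by right|right; split=> // w [<-|/cutT //]].
      by left.
    (* Here [f u] lies strictly between [f t] and [a], so [u] replaces [t]. *)
    exists u; split; [by left|right; split=> // w [<-|/cutT [le_wt|lt_aw]]].
    * by left.
    * by left; apply: le_trans le_wt (ltW lt_tu).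
    * by right.
- case: IH => [lt_aT|[t [tT [eq_at|[lt_ta cutT]]]]].
  + by left=> w [<-|/lt_aT].
  + by right; exists t; split; [right|left].
  + right; exists t; split; [by right|right; split=> // w [<-|/cutT //]].
    by right.
Qed.

End FiniteCuts.

(** * Terms and atoms of the signature *)

Notation assignment := (nat -> rat).

Definition value (v : assignment) (t : term tau0) : rat :=
  @eval tau0 structL v t.

Definition holds (v : assignment) (phi : formula tau0) : Prop :=
  @sat tau0 structL v phi.

Definition scale_term (c : rat) (t : term tau0) : term tau0 :=
  @TApp tau0 (Scale c) (fun=> t).

(** The variable is a dummy: the argument family is indexed by the empty type ['I_0]. *)
Definition one_term : term tau0 := @TApp tau0 One (fun=> TVar tau0 0).

Definition less_formula (s t : term tau0) : formula tau0 :=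
  @FRel tau0 Less (fun i => if i == ord0 then s else t).

Lemma value_scale v c t : value v (scale_term c t) = c * value v t.
Proof. by []. Qed.

Lemma holds_less v s t : holds v (less_formula s t) <-> value v s < value v t.
Proof. by []. Qed.

(** Reduces equality atoms to strict comparisons. *)
Lemma eq_not_lt (a b : rat) : a = b <-> ~ (a < b) /\ ~ (b < a).
Proof.
split=> [->|]; first by rewrite ltxx.
by case: (ltgtP a b) => // _ [].
Qed.

(** Atoms are boolean tests on rationals, so excluded middle holds here constructively; it serves to
    turn a universal quantifier into a negated existential one. *)
Lemma quantifier_free_decidable (phi : formula tau0) (v : assignment) :
  quantifier_free phi -> holds v phi \/ ~ holds v phi.
Proof.
rewrite /holds; elim: phi => [||s t|[] args|p IH|p IHp q IHq|p IHp q IHq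
  |p IHp q IHq|//|//] /=; try by [left|right].
- by move=> _; case: (eqVneq (value v s) (value v t)) => [|/eqP]; [left|right].
- by move=> _; case: (_ < _); [left|right].
- by move=> /IH; tauto.
- by move=> /andP[/IHp ? /IHq ?]; tauto.
- by move=> /andP[/IHp ? /IHq ?]; tauto.
- by move=> /andP[/IHp ? /IHq ?]; tauto.
Qed.

(** The truth of [P v a] for [a] in the region [R v] does not depend on [a] and
    is expressed by a quantifier-free formula. *)
Definition definable_on (R P : assignment -> rat -> Prop) : Prop :=
  exists psi : formula tau0, quantifier_free psi /\
    forall v a, R v a -> (P v a <-> holds v psi).

Definition definable (P : assignment -> Prop) : Prop :=
  exists psi : formula tau0, quantifier_free psi /\
    forall v, P v <-> holds v psi.

(** * Closure properties of definability *)

Section DefinableOn.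

Variable R : assignment -> rat -> Prop.
Implicit Types P Q : assignment -> rat -> Prop.

Lemma definable_on_ext P Q :
  (forall v a, R v a -> (P v a <-> Q v a)) -> definable_on R Q ->
  definable_on R P.
Proof.
move=> PQ [psi [qf Qpsi]]; exists psi; split=> // v a Rva.
by rewrite PQ // Qpsi.
Qed.

Lemma definable_on_formula (psi : formula tau0) :
  quantifier_free psi -> definable_on R (fun v _ => holds v psi).
Proof. by exists psi. Qed.

Lemma definable_on_not P :
  definable_on R P -> definable_on R (fun v a => ~ P v a).
Proof.
move=> [p [qfp Pp]]; exists (FNot p); split=> // v a Rva.
by move: (Pp v a Rva); rewrite /holds /=; tauto.
Qed.

Lemma definable_on_and P Q :
  definable_on R P -> definable_on R Q ->
  definable_on R (fun v a => P v a /\ Q v a).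
Proof.
move=> [p [qfp Pp]] [q [qfq Qq]]; exists (FAnd p q).
split=> [|v a Rva]; first by rewrite /= qfp.
by move: (Pp v a Rva) (Qq v a Rva); rewrite /holds /=; tauto.
Qed.

Lemma definable_on_or P Q :
  definable_on R P -> definable_on R Q ->
  definable_on R (fun v a => P v a \/ Q v a).
Proof.
move=> [p [qfp Pp]] [q [qfq Qq]]; exists (FOr p q).
split=> [|v a Rva]; first by rewrite /= qfp.
by move: (Pp v a Rva) (Qq v a Rva); rewrite /holds /=; tauto.
Qed.

Lemma definable_on_imp P Q :
  definable_on R P -> definable_on R Q ->
  definable_on R (fun v a => P v a -> Q v a).
Proof.
move=> [p [qfp Pp]] [q [qfq Qq]]; exists (FImp p q).
split=> [|v a Rva]; first by rewrite /= qfp.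
by move: (Pp v a Rva) (Qq v a Rva); rewrite /holds /=; tauto.
Qed.

(** On the region, [P v a] does not vary with [a], so its formula also expresses existence;
    inhabitedness supplies the witness. *)
Lemma definable_exists_region P :
  (forall v, exists a, R v a) -> definable_on R P ->
  definable (fun v => exists a, R v a /\ P v a).
Proof.
move=> R_inh [p [qfp Pp]]; exists p; split=> // v; split.
  by move=> [a [Rva Pva]]; apply/(Pp v a Rva).
by have [a Rva] := R_inh v => pv; exists a; split=> //; apply/(Pp v a Rva).
Qed.

End DefinableOn.

Lemma definable_ext (P Q : assignment -> Prop) :
  (forall v, P v <-> Q v) -> definable Q -> definable P.
Proof.
by move=> PQ [psi [qf Qpsi]]; exists psi; split=> // v; rewrite PQ.
Qed.

Lemma definable_or (P Q : assignment -> Prop) :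
  definable P -> definable Q -> definable (fun v => P v \/ Q v).
Proof.
move=> [p [qfp Pp]] [q [qfq Qq]]; exists (FOr p q).
split=> [|v]; first by rewrite /= qfp.
by rewrite Pp Qq.
Qed.

Lemma definable_exists_in (T : list (term tau0))
    (P : term tau0 -> assignment -> Prop) :
  (forall t, In t T -> definable (P t)) ->
  definable (fun v => exists t, In t T /\ P t v).
Proof.
elim: T => [|t T IH] defP.
  by exists (FFalse tau0); split=> // v; split=> // [[? []]].
apply: (@definable_ext _ (fun v => P t v \/ exists u, In u T /\ P u v)).
  move=> v; split; first by move=> [u [[<-|uT] Puv]]; [left|right; exists u].
  by move=> [Ptv|[u [uT Puv]]]; [exists t|exists u]; split=> //; [left|right].
by apply: definable_or; [apply: defP; left|apply: IH => u uT; apply: defP; right].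
Qed.

Definition decides (R : assignment -> rat -> Prop) (T : list (term tau0)) :=
  forall u, In u T -> definable_on R (fun v a => a < value v u) /\
                      definable_on R (fun v a => value v u < a).

Lemma decides_app R T1 T2 :
  decides R (T1 ++ T2) -> decides R T1 /\ decides R T2.
Proof. by move=> dec; split=> u uT; apply/dec/in_or_app; [left|right]. Qed.

(** Without addition, a term contains at most one variable: it is either independent of [x] or a
    nonzero multiple of it. *)
Lemma value_update x (t : term tau0) :
  (exists t', forall v a, value (update v x a) t = value v t') \/
  (exists c, c != 0 /\ forall v a, value (update v x a) t = c * a).
Proof.
elim: t => [y|[|c] args IH].
- case: (eqVneq y x) => [->|neq_yx]; [right|left].
    exists 1; split=> // v a; rewrite mul1r /value /= /update eqxx //.
  by exists (TVar tau0 y) => v a; rewrite /value /= /update (negPf neq_yx).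
- by left; exists one_term.
- have [->|c_neq0] := eqVneq c 0.
    (* Scaling by 0 erases [x]; the constant 0 is written as 0 times 1. *)
    left; exists (scale_term 0 one_term) => v a.
    by rewrite /value /= !mul0r.
  case: (IH ord0) => [[t' val_t']|[d [d_neq0 val_d]]].
    by left; exists (scale_term c t') => v a; rewrite value_scale -(val_t' v a).
  right; exists (c * d); split; first by rewrite mulf_neq0.
  by move=> v a; rewrite -mulrA -(val_d v a).
Qed.

(** Solving for [x] leaves at most one threshold term. [T] is chosen before [R], since the regions
    will be built from [T]. *)
Lemma less_decided x (s t : term tau0) :
  exists T, forall R, decides R T ->
    definable_on R (fun v a => value (update v x a) s < value (update v x a) t).
Proof.
case: (value_update x s) => [[s' val_s]|[c [c_neq0 val_s]]];
case: (value_update x t) => [[t' val_t]|[d [d_neq0 val_t]]].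
- exists nil => R _.
  apply: (definable_on_ext _ (@definable_on_formula R (less_formula s' t') _)) => //.
  by move=> v a _; rewrite holds_less val_s val_t.
- exists [:: scale_term d^-1 s'] => R /(_ _ (or_introl erefl)) [lt_a gt_a].
  (* Dividing by [d] reverses the inequality when [d] is negative. *)
  case: (ltgtP d 0) d_neq0 => // [d_lt0|d_gt0] _.
    apply: (definable_on_ext _ lt_a) => v a _.
    by rewrite val_s val_t value_scale ltr_ndivlMl.
  apply: (definable_on_ext _ gt_a) => v a _.
  by rewrite val_s val_t value_scale ltr_pdivrMl.
- exists [:: scale_term c^-1 t'] => R /(_ _ (or_introl erefl)) [lt_a gt_a].
  case: (ltgtP c 0) c_neq0 => // [c_lt0|c_gt0] _.
    apply: (definable_on_ext _ gt_a) => v a _.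
    by rewrite val_s val_t value_scale ltr_ndivrMl.
  apply: (definable_on_ext _ lt_a) => v a _.
  by rewrite val_s val_t value_scale ltr_pdivlMl.
(* [c * a < d * a] means [0 < (d - c) * a], so the threshold is 0. *)
- exists [:: scale_term 0 one_term] => R /(_ _ (or_introl erefl)) [lt_a gt_a].
  have [lt_cd|lt_dc|eq_cd] := ltgtP c d.
  + apply: (definable_on_ext _ gt_a) => v a _.
    rewrite val_s val_t value_scale mul0r -subr_gt0 -mulrBl pmulr_rgt0 //.
    by rewrite subr_gt0.
  + apply: (definable_on_ext _ lt_a) => v a _.
    rewrite val_s val_t value_scale mul0r -subr_gt0 -mulrBl nmulr_rgt0 //.
    by rewrite subr_lt0.
  + apply: (definable_on_ext _ (@definable_on_formula R (FFalse tau0) _)) => //.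
    by move=> v a _; rewrite val_s val_t eq_cd ltxx.
Qed.

Lemma quantifier_free_decided x (phi : formula tau0) :
  quantifier_free phi ->
  exists T, forall R, decides R T ->
    definable_on R (fun v a => holds (update v x a) phi).
Proof.
elim: phi => [||s t|[] args|p IH|p IHp q IHq|p IHp q IHq
  |p IHp q IHq|//|//] /=.
- by exists nil => R _; apply: (@definable_on_formula R (FTrue tau0)).
- by exists nil => R _; apply: (@definable_on_formula R (FFalse tau0)).
- have [T1 dec1] := less_decided x s t; have [T2 dec2] := less_decided x t s.
  exists (T1 ++ T2) => R /decides_app [/dec1 lt_st /dec2 lt_ts].
  apply: definable_on_ext (definable_on_and (definable_on_not lt_st)
                                            (definable_on_not lt_ts)).
  by move=> v a _; apply: eq_not_lt.
- by move=> _; apply: less_decided.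
- move=> /IH [T decT]; exists T => R /decT.
  exact: definable_on_not.
all: move=> /andP[/IHp [T1 dec1] /IHq [T2 dec2]].
all: exists (T1 ++ T2) => R /decides_app [/dec1 defp /dec2 defq].
- exact: definable_on_and.
- exact: definable_on_or.
- exact: definable_on_imp.
Qed.

(** * The regions cut out by the terms *)

Section Regions.

Variable T : list (term tau0).

Definition below_region (v : assignment) (a : rat) : Prop :=
  forall u, In u T -> a < value v u.

Definition point_region (t : term tau0) (v : assignment) (a : rat) : Prop :=
  a = value v t.

(** The open interval from [t] to the next larger value of [T], or to infinity; it stands for a
    point infinitesimally above [t]. *)
Definition just_above_region (t : term tau0) (v : assignment) (a : rat) : Prop :=
  value v t < a /\ forall u, In u T -> value v u <= value v t \/ a < value v u.

Lemma below_region_decides : decides below_region T.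
Proof.
move=> u uT; split.
  exists (FTrue tau0); split=> // v a /(_ u uT) lt_au.
  by split=> // _; rewrite lt_au.
exists (FFalse tau0); split=> // v a /(_ u uT) lt_au.
by split=> //; rewrite ltNge (ltW lt_au).
Qed.

Lemma point_region_decides t : decides (point_region t) T.
Proof.
by move=> u uT; split; [exists (less_formula t u)|exists (less_formula u t)];
  split=> // v a ->; rewrite holds_less.
Qed.

(** No value of [T] separates [t] from [a], so [a < u] amounts to [t < u], and [u < a] to its
    negation. *)
Lemma just_above_region_decides t : decides (just_above_region t) T.
Proof.
move=> u uT; split.
  exists (less_formula t u); split=> // v a [lt_ta /(_ u uT) cut_u].
  rewrite holds_less; split=> [lt_au|lt_tu]; first exact: lt_trans lt_ta lt_au.
  by case: cut_u => //; rewrite leNgt lt_tu.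
exists (FNot (less_formula t u)); split=> // v a [lt_ta /(_ u uT) cut_u].
rewrite -[holds _ _]/(~ value v t < value v u).
split=> [lt_ua lt_tu|/negP]; last by rewrite -leNgt => /le_lt_trans; apply.
case: cut_u; first by rewrite leNgt lt_tu.
by move=> /(lt_trans lt_ua); rewrite ltxx.
Qed.

End Regions.

(** * Elimination of quantifiers *)

Lemma exists_definable x (phi : formula tau0) :
  quantifier_free phi -> definable (fun v => exists a, holds (update v x a) phi).
Proof.
move=> /(quantifier_free_decided x) [T decT].
pose P (v : assignment) a := holds (update v x a) phi.
(* The regions cover the line, so the existential splits into a finite disjunction over them. *)
apply: (@definable_ext _ (fun v =>
  (exists a, below_region T v a /\ P v a) \/
  exists t, In t T /\ ((exists a, point_region t v a /\ P v a) \/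
                       (exists a, just_above_region T t v a /\ P v a)))).
  move=> v; split=> [[a Pva]|].
    case: (below_or_at_or_just_above (value v) a T) => [Ra|[t [tT Ra]]].
      by left; exists a.
    by right; exists t; split=> //; case: Ra => Ra; [left|right]; exists a.
  by move=> [[a []]|[t [tT [[a []]|[a []]]]]] *; exists a.
apply: definable_or.
  apply: definable_exists_region; last exact/decT/below_region_decides.
  by move=> v; apply: exists_below.
apply: definable_exists_in => t tT.
apply: definable_or.
  apply: definable_exists_region; last exact/decT/point_region_decides.
  by move=> v; exists (value v t).
apply: definable_exists_region; last exact/decT/just_above_region_decides.
by move=> v; apply: exists_just_above.
Qed.

Theorem theorem2 : has_quantifier_elimination structL.
Proof.
elim=> [||s t|r args|p [p' [qfp pp']]|p [p' [qfp pp']] q [q' [qfq qq']]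
  |p [p' [qfp pp']] q [q' [qfq qq']]|p [p' [qfp pp']] q [q' [qfq qq']]
  |x p [p' [qfp pp']]|x p [p' [qfp pp']]].
- by exists (FTrue tau0).
- by exists (FFalse tau0).
- by exists (FEq s t).
- by exists (FRel args).
- by exists (FNot p'); split=> // v; move: (pp' v) => /=; tauto.
- exists (FAnd p' q'); split=> [|v]; first by rewrite /= qfp.
  by move: (pp' v) (qq' v) => /=; tauto.
- exists (FOr p' q'); split=> [|v]; first by rewrite /= qfp.
  by move: (pp' v) (qq' v) => /=; tauto.
- exists (FImp p' q'); split=> [|v]; first by rewrite /= qfp.
  by move: (pp' v) (qq' v) => /=; tauto.
- have [psi [qf ex_psi]] := exists_definable x qfp.
  exists psi; split=> // v; rewrite -[sat v psi]/(holds v psi) -ex_psi.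
  by split=> -[a]; exists a; apply/pp'.
(* The universal quantifier is treated as the negation of an existential over [FNot p']. *)
- have [psi [qf ex_psi]] := @exists_definable x (FNot p') qfp.
  exists (FNot psi); split=> // v.
  rewrite -[sat v (FNot psi)]/(~ holds v psi) -ex_psi.
  split=> [all_p [a]|no_a a]; first by apply; apply/pp'.
  (* Decidability of [p'] removes the double negation. *)
  apply/pp'; case: (quantifier_free_decidable (update v x a) qfp) => // np'.
  by case: no_a; exists a.
Qed.
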